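(* Let $\Bbbk$ be a field of characteristic zero, let $U(3)$ and $M_{(\alpha,\Delta)}$ be as defined below, and let $\alpha,\Delta\in\Bbbk$ with $\alpha\neq 0$. Then $H^n(U(3),M_{(\alpha,\Delta)})=0$ for all $n\ge1$.
   Context: A conformal algebra over $\Bbbk$ is a $\Bbbk[\partial]$-module $C$ with a bilinear $\lambda$-product $(a\,{}_{\lambda}\,b)=\sum_{n\ge0}\frac{\lambda^n}{n!}(a\,{}_{(n)}\,b)\in C[\lambda]$ satisfying $(\partial a\,{}_\lambda\, b)=-\lambda(a\,{}_\lambda\, b)$ and $(a\,{}_\lambda\,\partial b)=(\partial+\lambda)(a\,{}_\lambda\, b)$; it is associative if $a\,{}_\lambda(b\,{}_\mu c)=(a\,{}_\lambda b)\,{}_{\lambda+\mu} c$. $U(3)$ is the associative conformal algebra generated by one element $v$ subject to $v\,{}_{(n)}\,v=0$ for $n\ge 3$ and $2\,v\,{}_{(1)}\,v-\partial(v\,{}_{(2)}\,v)=2v$. A left conformal module over an associative conformal algebra $C$ is a $\Bbbk[\partial]$-module $M$ with a bilinear map $a\otimes m\mapsto a\,{}_\lambda m\in M[\lambda]$ satisfying $(\partial a)\,{}_\lambda m=-\lambda(a\,{}_\lambda m)$, $a\,{}_\lambda\,\partial m=(\partial+\lambda)(a\,{}_\lambda m)$, $a\,{}_\lambda(b\,{}_\mu m)=(a\,{}_\lambda b)\,{}_{\lambda+\mu}m$. $M_{(\alpha,\Delta)}=\Bbbk[\partial]u$ with $v\,{}_\lambda\, u=(\alpha+\partial+\Delta\lambda)u$,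 a conformal $U(3)$-module. Hochschild cohomology: the basic complex $\tilde C^n(C,M)$ ($n\ge1$) consists of maps $\varphi_{\bar\lambda}:C^{\otimes n}\to M[\lambda_1,\dots,\lambda_n]$ with $\varphi_{\bar\lambda}(a_1,\dots,\partial a_i,\dots,a_n)=-\lambda_i\varphi_{\bar\lambda}(a_1,\dots,a_n)$, $\tilde C^0=M$, with differential $(d\varphi)_{\bar\lambda}(a_1,\dots,a_{n+1})=a_1\,{}_{\lambda_1}\varphi_{(\lambda_2,\dots,\lambda_{n+1})}(a_2,\dots,a_{n+1})+\sum_{i=1}^n(-1)^i\varphi_{(\lambda_1,\dots,\lambda_i+\lambda_{i+1},\dots,\lambda_{n+1})}(a_1,\dots,a_i\,{}_{\lambda_i}a_{i+1},\dots,a_{n+1})$ (for $n=0$: $(dm)_\lambda(a)=a\,{}_\lambda m$). $\partial$ acts on $\tilde C^n$ by $(\partial\varphi)_{\bar\lambda}=(\partial+\sum_i\lambda_i)\varphi_{\bar\lambda}$, commuting with $d$; $H^n(C,M)$ is the cohomology of the reduced complex $\tilde C^\bullet(C,M)/\partial\tilde C^\bullet(C,M)$. *)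

(* Defs.v *)
From HB Require Import structures.
From mathcomp Require Import all_boot all_order all_algebra.
Set Implicit Arguments. Unset Strict Implicit. Unset Printing Implicit Defensive.
Import GRing.Theory.
Local Open Scope ring_scope.

(* Convention: an element of V[lambda_1,...,lambda_n] is represented by the
   polynomial function (F^n -> V) it defines; since char F = 0, F is infinite
   and this identification is bijective.  Substitutions such as
   lambda_i + lambda_{i+1} become evaluation. *)

Section Conformal.
Variable F : fieldType.

Definition polyfun1 (V : lmodType F) (f : F -> V) : Prop :=
  exists s : seq V, forall l : F, f l = \sum_(i < size s) l ^+ i *: s`_i.

Definition polyfun (V : lmodType F) (n : nat) (f : ('I_n -> F) -> V) : Prop :=
  exists (N : nat) (c : {ffun 'I_n -> 'I_N} -> V),
    forall l : 'I_n -> F,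
      f l = \sum_(e : {ffun 'I_n -> 'I_N}) (\prod_(i < n) l i ^+ e i) *: c e.

Definition klin (V W : lmodType F) (f : V -> W) : Prop :=
  forall (a : F) (x y : V), f (a *: x + y) = a *: f x + f y.

(* conformal algebra: k[d]-module (C, D) with a lambda-product pr a b lambda *)
Record conf_alg (C : lmodType F) (D : C -> C) (pr : C -> C -> F -> C) : Prop := {
  conf_D_lin : klin D;
  conf_lin_l : forall b l, klin (fun a => pr a b l);
  conf_lin_r : forall a l, klin (fun b => pr a b l);
  conf_poly : forall a b, polyfun1 (pr a b);
  conf_Dl : forall a b l, pr (D a) b l = - l *: pr a b l;
  conf_Dr : forall a b l, pr a (D b) l = D (pr a b l) + l *: pr a b l }.

Definition assoc_conf_alg (C : lmodType F) (D : C -> C) (pr : C -> C -> F -> C) : Prop :=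
  conf_alg D pr /\
  forall a b c l m, pr a (pr b c m) l = pr (pr a b l) c (l + m).

(* f n = a_(n) b, i.e. a_lambda b = sum_n lambda^n/n! (a_(n) b) *)
Definition nprods (C : lmodType F) (pr : C -> C -> F -> C) (a b : C) (f : nat -> C) : Prop :=
  exists N : nat, (forall n, (N <= n)%N -> f n = 0) /\
    forall l, pr a b l = \sum_(n < N) (l ^+ n / (n`!)%:R) *: f n.

Definition U3_rel (C : lmodType F) (D : C -> C) (pr : C -> C -> F -> C) (v : C) : Prop :=
  exists f : nat -> C, nprods pr v v f /\
    (forall n, (3 <= n)%N -> f n = 0) /\
    2%:R *: f 1%N - D (f 2%N) = 2%:R *: v.

Definition conf_hom (C C' : lmodType F) (D : C -> C) (pr : C -> C -> F -> C)
  (D' : C' -> C') (pr' : C' -> C' -> F -> C') (f : C -> C') : Prop :=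
  klin f /\ (forall a, f (D a) = D' (f a)) /\
  (forall a b l, f (pr a b l) = pr' (f a) (f b) l).

Definition is_U3 (C : lmodType F) (D : C -> C) (pr : C -> C -> F -> C) (v : C) : Prop :=
  assoc_conf_alg D pr /\ U3_rel D pr v /\
  forall (C' : lmodType F) (D' : C' -> C') (pr' : C' -> C' -> F -> C') (w : C'),
    assoc_conf_alg D' pr' -> U3_rel D' pr' w ->
    (exists f : C -> C', conf_hom D pr D' pr' f /\ f v = w) /\
    (forall f g : C -> C', conf_hom D pr D' pr' f -> f v = w ->
       conf_hom D pr D' pr' g -> g v = w -> forall x, f x = g x).

Record conf_mod (C : lmodType F) (D : C -> C) (pr : C -> C -> F -> C)
  (M : lmodType F) (DM : M -> M) (act : C -> M -> F -> M) : Prop := {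
  mod_D_lin : klin DM;
  mod_lin_l : forall m l, klin (fun a => act a m l);
  mod_lin_r : forall a l, klin (fun m => act a m l);
  mod_poly : forall a m, polyfun1 (act a m);
  mod_Dl : forall a m l, act (D a) m l = - l *: act a m l;
  mod_Dr : forall a m l, act a (DM m) l = DM (act a m l) + l *: act a m l;
  mod_assoc : forall a b m l mu, act a (act b m mu) l = act (pr a b l) m (l + mu) }.

(* M_(alpha,Delta) = k[d] u, realised as {poly F} with d = 'X * _ and u = 1 *)
Definition Mpoly_D (p : {poly F}) : {poly F} := 'X * p.

Definition is_M_alpha_Delta (C : lmodType F) (D : C -> C) (pr : C -> C -> F -> C)
  (v : C) (alpha Delta : F) (act : C -> {poly F} -> F -> {poly F}) : Prop :=
  conf_mod D pr Mpoly_D act /\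
  forall l, act v 1 l = (alpha + Delta * l)%:P + 'X * 1.

Section Cochains.
Variables (C M : lmodType F) (D : C -> C) (pr : C -> C -> F -> C)
  (DM : M -> M) (act : C -> M -> F -> M).

Definition cochain (n : nat) := ('I_n -> C) -> ('I_n -> F) -> M.

Definition upd (X : Type) (n : nat) (f : 'I_n -> X) (i : 'I_n) (x : X) : 'I_n -> X :=
  fun j => if j == i then x else f j.

Definition is_cochain (n : nat) (phi : cochain n) : Prop :=
  (forall (args : 'I_n -> C) (i : 'I_n) (a : F) (x y : C) (l : 'I_n -> F),
     phi (upd args i (a *: x + y)) l = a *: phi (upd args i x) l + phi (upd args i y) l) /\
  (forall (args : 'I_n -> C) (i : 'I_n) (l : 'I_n -> F),
     phi (upd args i (D (args i))) l = - l i *: phi args l) /\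
  (forall args : 'I_n -> C, polyfun (phi args)).

Definition merge_args (n : nat) (args : 'I_n.+1 -> C) (l : 'I_n.+1 -> F) (j : 'I_n)
  : 'I_n -> C :=
  fun k => if (k < j)%N then args (inord k)
           else if k == j then pr (args (inord j)) (args (inord j.+1)) (l (inord j))
           else args (inord k.+1).

Definition merge_lam (n : nat) (l : 'I_n.+1 -> F) (j : 'I_n) : 'I_n -> F :=
  fun k => if (k < j)%N then l (inord k)
           else if k == j then l (inord j) + l (inord j.+1)
           else l (inord k.+1).

Definition dco (n : nat) (phi : cochain n) : cochain n.+1 :=
  fun args l =>
    act (args ord0) (phi (fun k => args (lift ord0 k)) (fun k => l (lift ord0 k))) (l ord0)
    + \sum_(j < n) (-1) ^+ j.+1 *: phi (merge_args args l j) (merge_lam l j).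

Definition Dco (n : nat) (phi : cochain n) : cochain n :=
  fun args l => DM (phi args l) + (\sum_(i < n) l i) *: phi args l.

(* H^{m+1}(C, M) = 0 for the reduced complex C~ / d C~ *)
Definition H_vanishes (m : nat) : Prop :=
  forall phi : cochain m.+1, is_cochain phi ->
    (exists theta : cochain m.+2, is_cochain theta /\
       forall args l, dco phi args l = Dco theta args l) ->
    exists (psi : cochain m) (chi : cochain m.+1),
      is_cochain psi /\ is_cochain chi /\
      forall args l, phi args l = dco psi args l + Dco chi args l.

End Cochains.
End Conformal.

(* Main.v *)
Require Import Defs.
From HB Require Import structures.
From mathcomp Require Import all_boot all_order all_algebra.
From mathcomp Require Import boolp zify ring.
Import GRing.Theory.
Local Open Scope ring_scope.
Set Implicit Arguments. Unset Strict Implicit. Unset Printing Implicit Defensive.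

(* The defining relation of U(3) makes the commutator with v_(0) equal to D on v,
   hence on all of U(3), which v generates.  Inner derivations act trivially on
   Hochschild cohomology: inserting v with variable 0 in every slot, with
   alternating signs, is a homotopy h.  As v_(0) acts on M_(alpha,Delta) by
   D + alpha, one gets d h + h d = D + alpha on basic cochains, and h commutes
   with D.  So if d phi = D theta, then
   phi = d (h phi / alpha) + D ((h theta - phi) / alpha). *)

(** * Submodules as modules, and generation of U(3) by [v] *)

Section SubModule.
Variables (F : fieldType) (V : lmodType F) (P : submodClosed V).
Record submodule := Submodule { submodule_val : V; _ : submodule_val \in P }.
HB.instance Definition _ := [isSub for submodule_val].
HB.instance Definition _ := [Choice of submodule by <:].
HB.instance Definition _ := [SubChoice_isSubLmodule of submodule by <:].
End SubModule.

Section Generation.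
Variables (F : fieldType) (charF0 : [pchar F] =i pred0).

(** Induction on the number of coefficients. Subtracting [2 ^ N] times the value at [l] from the
    value at [2 * l] removes the top term and multiplies [c i] by [2 ^ i - 2 ^ N], which is
    invertible in characteristic zero. *)
Lemma coef_in_submod (V : lmodType F) (P : submodClosed V) (N : nat) (c : nat -> V) :
  (forall l : F, \sum_(i < N) l ^+ i *: c i \in P) ->
  forall i, (i < N)%N -> c i \in P.
Proof.
elim: N c => [//|N IHN] c cP.
have c_lt i : (i < N)%N -> c i \in P.
  move=> iN; have two0 : (2%:R ^+ i - 2%:R ^+ N : F) != 0.
    rewrite subr_eq0 eq_sym -subr_eq0 -!natrX -natrB ?leq_pexp2l //; last exact: ltnW.
    by rewrite (proj1 (pcharf0P F) charF0) subn_eq0 -ltnNge ltn_exp2l.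
  rewrite -[c i](scalerK two0) rpredZ //.
  apply: (IHN (fun i => (2%:R ^+ i - 2%:R ^+ N) *: c i)) => // l.
  have := rpredD (cP (2%:R * l)) (rpredZ (- 2%:R ^+ N) (cP l)).
  rewrite scaleNr scaler_sumr -sumrB big_ord_recr /= scalerA exprMn subrr addr0.
  rewrite (eq_bigr (fun j : 'I_N => l ^+ j *: ((2%:R ^+ j - 2%:R ^+ N) *: c j))) // => j _.
  by rewrite !scalerA exprMn -scalerBl -mulrBl mulrC.
(* The top coefficient is the value at 1 minus the lower coefficients. *)
move=> i; rewrite ltnS leq_eqVlt => /predU1P[->|]; last exact: c_lt.
have := cP 1; rewrite big_ord_recr /= expr1n scale1r => cP1.
rewrite -[c N](addKr (\sum_(j < N) 1 ^+ j *: c j)) -scaleN1r rpredD ?rpredZ //.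
by apply: rpred_sum => j _; rewrite rpredZ ?c_lt.
Qed.

Variables (C : lmodType F) (D : C -> C) (pr : C -> C -> F -> C) (v : C).
Hypothesis hU3 : is_U3 D pr v.
Variable P : submodClosed C.
Hypotheses (Pv : v \in P) (PD : forall a, a \in P -> D a \in P).
Hypothesis Ppr : forall a b l, a \in P -> b \in P -> pr a b l \in P.

Let sC := submodule P.
Let sD (a : sC) : sC := Submodule (PD (valP a)).
Let spr (a b : sC) l : sC := Submodule (Ppr l (valP a) (valP b)).

Lemma submodule_assoc_conf_alg : assoc_conf_alg sD spr.
Proof.
have [[[Dlin linl linr polypr Dl Dr] prA] _] := hU3.
split; last by move=> a b c l m; apply: val_inj; apply: prA.
split.
- by move=> a x y; apply: val_inj; rewrite /= !(linearP, Dlin).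
- by move=> b l a x y; apply: val_inj; apply: linl.
- by move=> b l a x y; apply: val_inj; apply: linr.
(* Polynomiality is not inherited for free: the coefficients of the product must themselves lie in
   [P]. *)
- move=> a b; have [s prE] := polypr (val a) (val b).
  have sP i : s`_i \in P.
    have [/(nth_default 0)->|] := leqP (size s) i; first exact: rpred0.
    by apply: (@coef_in_submod _ _ _ (nth 0 s)) => l; rewrite -prE; apply: Ppr; apply: valP.
  exists (mkseq (fun i => Submodule (sP i)) (size s)) => l; apply: val_inj.
  rewrite raddf_sum [LHS]prE size_mkseq; apply: eq_bigr => i _.
  by rewrite nth_mkseq.
- by move=> a b l; apply: val_inj; apply: Dl.
- by move=> a b l; apply: val_inj; apply: Dr.
Qed.

Lemma submodule_U3_rel : U3_rel sD spr (Submodule Pv).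
Proof.
have [_ [[f [[N [f0 prE]] [f3 rel]]] _]] := hU3.
have fP i : f i \in P.
  have [/f0->|iN] := leqP N i; first exact: rpred0.
  have fact0 : (i`!%:R : F) != 0 by rewrite (proj1 (pcharf0P F) charF0) -lt0n fact_gt0.
  rewrite -[f i](scalerKV fact0) rpredZ //.
  apply: (@coef_in_submod _ _ N (fun i => i`!%:R^-1 *: f i)) => // l.
  under eq_bigr do rewrite scalerA; rewrite -prE; exact: Ppr.
exists (fun i => Submodule (fP i)); split.
  exists N; split=> [n /f0 fn0|l]; apply: val_inj => //.
  by rewrite raddf_sum [LHS]prE.
split=> [n /f3 fn0|]; apply: val_inj => //.
Qed.

(** The universal property gives a map from U(3) to the subalgebra. Followed by the inclusion it
    fixes [v], so by uniqueness it is the identity. *)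
Lemma U3_generated x : x \in P.
Proof.
have [aC [rC univ]] := hU3.
have [[f [[flin [fD fpr]] fv]] _] := univ _ _ _ _ submodule_assoc_conf_alg submodule_U3_rel.
have [_ uniq_id] := univ _ _ _ _ aC rC.
suff -> : x = val (f x) by exact: valP.
apply: (uniq_id id (val \o f)) => //=.
- split; first by move=> a y z /=; rewrite flin.
  by split=> [a|a b l] /=; rewrite ?fD ?fpr.
- by rewrite fv.
Qed.

End Generation.

(** * Linear maps given as bare functions *)

Section Klin.
Variables (F : fieldType) (V W : lmodType F) (f : V -> W) (flin : klin f).

Lemma klinD x y : f (x + y) = f x + f y.
Proof. by rewrite -[x in LHS]scale1r flin scale1r. Qed.

Lemma klin0 : f 0 = 0.
Proof. by apply: (@addrI _ (f 0)); rewrite -klinD !addr0. Qed.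

Lemma klinZ a x : f (a *: x) = a *: f x.
Proof. by rewrite -[a *: x]addr0 flin klin0 addr0. Qed.

Lemma klinN x : f (- x) = - f x.
Proof. by rewrite -!scaleN1r klinZ. Qed.

Lemma klin_sum (I : Type) (r : seq I) (P : pred I) (E : I -> V) :
  f (\sum_(i <- r | P i) E i) = \sum_(i <- r | P i) f (E i).
Proof. exact: (big_morph f klinD klin0). Qed.
End Klin.

(** * Commutation with [v_(0)] in U(3) *)

Section InnerDerivation.
Variables (F : fieldType) (charF0 : [pchar F] =i pred0).
Variables (C : lmodType F) (D : C -> C) (pr : C -> C -> F -> C) (v : C).
Hypothesis hU3 : is_U3 D pr v.

(** The elements satisfying [P] form a conformal subalgebra containing [v], hence all of U(3). *)
Lemma U3_ind (P : C -> Prop) :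
  P v -> (forall (k : F) a b, P a -> P b -> P (k *: a + b)) ->
  (forall a, P a -> P (D a)) -> (forall a b l, P a -> P b -> P (pr a b l)) ->
  forall a, P a.
Proof.
move=> Pv Plin PD Ppr a; pose Q : {pred C} := fun x => `[< P x >].
have Qclosed : submod_closed Q.
  split; last by move=> k x y /asboolP Px /asboolP Py; apply/asboolP/Plin.
  by apply/asboolP; rewrite -(addNr v) -scaleN1r; apply: Plin.
pose S : submodClosed C := HB.pack Q (GRing.isSubmodClosed.Build F C Q Qclosed).
suff /asboolP : a \in S by [].
apply: (U3_generated charF0 hU3).
- exact/asboolP.
- by move=> b /asboolP Pb; apply/asboolP/PD.
- by move=> b c l /asboolP Pb /asboolP Pc; apply/asboolP/Ppr.
Qed.

Lemma U3_vv : exists f1 f2 : C, 2%:R *: f1 - D f2 = 2%:R *: v /\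
  forall l, pr v v l = pr v v 0 + l *: f1 + (l ^+ 2 / 2%:R) *: f2.
Proof.
have [_ [[f [[N [f0 prE]] [f3 rel]]] _]] := hU3.
exists (f 1%N), (f 2%N); split=> //.
have prE3 l : pr v v l = f 0%N + l *: f 1%N + (l ^+ 2 / 2%:R) *: f 2%N.
  (* The [n]-products vanish both from [N] on and from 3 on, so the sums of lengths [N] and 3 agree
     with the one of length [N + 3]. *)
  have widen K : (K <= N + 3)%N -> (forall n, (K <= n)%N -> f n = 0) ->
    \sum_(n < K) (l ^+ n / n`!%:R) *: f n = \sum_(n < N + 3) (l ^+ n / n`!%:R) *: f n.
    move=> leK fK; rewrite (big_ord_widen _ (fun n => (l ^+ n / n`!%:R) *: f n) leK).
    rewrite big_mkcond; apply: eq_bigr => n _.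
    by case: ltnP => // /fK ->; rewrite scaler0.
  rewrite prE widen ?leq_addr // -(widen 3%N) ?leq_addl //.
  by rewrite !big_ord_recr big_ord0 /= add0r expr0 expr1 !divr1 scale1r.
by move=> l; rewrite !prE3 expr0n mul0r !scale0r !addr0.
Qed.

(* This says [v_(0), a] = D a in the annihilation algebra: a cochain slot carrying
   the variable mu kills (D + mu) C, and there a _mu v stands for a v_(0). *)
Lemma U3_inner_derivation a mu :
  exists c, pr v a 0 - pr a v mu + mu *: a = D c + mu *: c.
Proof.
have [[[Dlin linl linr _ Dl Dr] prA] _] := hU3.
move: a mu; apply: U3_ind.
(* The defining relation gives [mu v = mu f1 - (mu/2) D f2]. The terms in [f1] cancel and
   [-(mu/2) (D + mu) f2] is left. *)
- have [f1 [f2 [rel vvE]]] := U3_vv => mu; exists (- (mu / 2%:R) *: f2).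
  have two0 : (2%:R : F) != 0 by rewrite (proj1 (pcharf0P F) charF0).
  have muv : mu *: v = mu *: f1 - (mu / 2%:R) *: D f2.
    apply: (scalerI two0); rewrite scalerA [2%:R * mu]mulrC -[LHS]scalerA -rel !scalerBr !scalerA.
    by rewrite [2%:R * mu]mulrC [2%:R * (_ / _)]mulrC divfK.
  rewrite (vvE mu) muv (klinZ Dlin) scalerA mulrN mulrA -expr2 !scaleNr !opprD !addrA subrr add0r.
  by rewrite [- (mu *: f1) - _]addrC subrK addrC.
- move=> k a b Pa Pb mu; have [[ca eqa] [cb eqb]] := (Pa mu, Pb mu).
  exists (k *: ca + cb); rewrite Dlin linl linr !scalerDr [RHS]addrACA.
  have scaleC (x : C) : mu *: (k *: x) = k *: (mu *: x) by rewrite !scalerA mulrC.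
  rewrite !scaleC -scalerDr -eqa -eqb opprD [X in X + _ = _]addrACA [LHS]addrACA.
  by rewrite -scalerN -!scalerDr.
(* Applying [D] to the identity for [a] gives all but [(D + mu)] of [pr a v mu], which the second
   summand supplies. *)
- move=> a Pa mu; have [c eqc] := Pa mu; exists (D c + pr a v mu).
  have := congr1 D eqc; rewrite !(klinD Dlin, klinN Dlin, klinZ Dlin) => eqDc.
  rewrite Dl Dr scale0r addr0 scaleNr opprK scalerDr [RHS]addrACA -eqDc.
  by rewrite [RHS]addrACA subrK -addrA [mu *: pr a v mu + _]addrC.
(* Leibniz rule: the variable [mu] of the product splits as [nu] for [a] and [mu - nu] for [b].
   Multiplied by [b], the error of [a] vanishes, since [D + nu] is killed in the left factor; the
   error of [b] becomes [(D + mu)] of [pr a cb nu]. *)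
- move=> a b nu Pa Pb mu; have [[ca ea] [cb eb]] := (Pa nu, Pb (mu - nu)).
  exists (pr a cb nu); set w := pr a b nu.
  have lpr x y : pr (x + y) b nu = pr x b nu + pr y b nu := klinD (linl _ _) _ _.
  have rpr x y : pr a (x + y) nu = pr a x nu + pr a y nu := klinD (linr _ _) _ _.
  have /eqP : pr v w 0 - pr a (pr v b 0) nu + nu *: w = 0.
    have := congr1 (fun x => pr x b nu) ea.
    rewrite /= !(lpr, klinN (linl _ _), klinZ (linl _ _)) Dl scaleNr addNr.
    rewrite /w (prA v) add0r (prA a v) addr0.
    done.
  rewrite addrAC subr_eq0 => /eqP wE.
  have /= := congr1 (fun x => pr a x nu) eb.
  rewrite !(rpr, klinN (linr _ _), klinZ (linr _ _)) Dr (prA a b) -/w [nu + _]addrC subrK.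
  rewrite -[in RHS]addrA -[in RHS]scalerDl [nu + _]addrC subrK => <-.
  by rewrite -wE scalerBl [pr v w 0 + _ - _]addrAC -[RHS]addrA [nu *: w + _]addrC subrK.
Qed.

End InnerDerivation.

(** * Closure properties of polynomial functions *)

Section PolynomialFunctions.
Variables (F : fieldType) (V : lmodType F).

(** Lists of monomials carry no common bound on exponents, so sums become concatenations and
    substitutions become maps. *)
Lemma polyfunP n (f : ('I_n -> F) -> V) :
  polyfun f <-> exists s : seq ({ffun 'I_n -> nat} * V),
    forall l, f l = \sum_(t <- s) (\prod_i l i ^+ t.1 i) *: t.2.
Proof.
split=> [[N [c fE]]|[s fE]].
  exists [seq ([ffun i => e i : nat], c e) | e : {ffun 'I_n -> 'I_N} <- index_enum _] => l.
  rewrite fE big_map; apply: eq_bigr => e _; congr (_ *: _).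
  by apply: eq_bigr => i _; rewrite ffunE.
pose N := (\max_(t <- s) \max_i t.1 i).+1.
have ltN t i : t \in s -> ((t.1 i : nat) < N)%N.
  move=> ts; rewrite ltnS; apply: (leq_trans (leq_bigmax i)).
  by rewrite (big_rem _ ts) /= leq_maxl.
(* An exponent may occur several times in [s], so its entries are added up. *)
exists N, (fun e : {ffun 'I_n -> 'I_N} => \sum_(t <- s | [forall i, t.1 i == e i]) t.2) => l.
rewrite fE; under [RHS]eq_bigr do rewrite scaler_sumr big_mkcond.
rewrite exchange_big /= [LHS]big_seq [RHS]big_seq; apply: eq_bigr => t ts.
rewrite -big_mkcond /= (big_pred1 [ffun i => Ordinal (ltN t i ts)]) => [|e].
  by congr (_ *: _); apply: eq_bigr => i _; rewrite ffunE.
apply/forallP/eqP => [te|-> i]; last by rewrite ffunE.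
by apply/ffunP => i; rewrite ffunE; apply: val_inj; rewrite /= (eqP (te i)).
Qed.

Lemma polyfun0 n : polyfun (fun _ : 'I_n -> F => 0 : V).
Proof. by apply/polyfunP; exists [::] => l; rewrite big_nil. Qed.

Lemma polyfun_lin n a (f g : ('I_n -> F) -> V) :
  polyfun f -> polyfun g -> polyfun (fun l => a *: f l + g l).
Proof.
move=> /polyfunP[s fE] /polyfunP[s' gE]; apply/polyfunP.
exists ([seq (t.1, a *: t.2) | t <- s] ++ s') => l.
rewrite fE gE big_cat big_map scaler_sumr /=; congr (_ + _).
by apply: eq_bigr => t _; rewrite !scalerA mulrC.
Qed.

Lemma polyfun_sum n m (c : 'I_m -> F) (f : 'I_m -> ('I_n -> F) -> V) :
  (forall k, polyfun (f k)) -> polyfun (fun l => \sum_k c k *: f k l).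
Proof.
move=> fpoly; elim: (index_enum _) => [|k r IHr].
  by under eq_fun do rewrite big_nil; apply: polyfun0.
by under eq_fun do rewrite big_cons; apply: polyfun_lin.
Qed.

End PolynomialFunctions.

(** * Inserting a slot, and the combinatorics of insertions and merges *)

Section Insertion.
Variables (X : Type) (n : nat).

Definition ins (k : 'I_n.+1) (x : X) (f : 'I_n -> X) : 'I_n.+1 -> X :=
  fun i => oapp f x (unlift k i).

Lemma ins_lift k x f j : ins k x f (lift k j) = f j.
Proof. by rewrite /ins liftK. Qed.

Lemma ins_at k x f : ins k x f k = x.
Proof. by rewrite /ins unlift_none. Qed.

Lemma ins_upd k x f j y : ins k x (upd f j y) = upd (ins k x f) (lift k j) y.
Proof.
apply: funext => i; rewrite /upd; case: (unliftP k i) => [i'|] ->.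
  by rewrite !ins_lift (inj_eq lift_inj).
by rewrite !ins_at (negbTE (neq_lift _ _)).
Qed.

End Insertion.

Lemma upd_upd (X : Type) n (f : 'I_n -> X) i x y : upd (upd f i x) i y = upd f i y.
Proof. by apply: funext => j; rewrite /upd; case: eqP. Qed.

Lemma upd_id (X : Type) n (f : 'I_n -> X) i : upd f i (f i) = f.
Proof. by apply: funext => j; rewrite /upd; case: eqP => [->|]. Qed.

(** Each monomial loses slot [k], and the factor [0 ^+ t.1 k] goes into its coefficient;
    [0 ^+ 0 = 1] keeps the monomials free of that variable. *)
Lemma polyfun_ins0 (F : fieldType) (V : lmodType F) n (k : 'I_n.+1)
  (f : ('I_n.+1 -> F) -> V) : polyfun f -> polyfun (fun l => f (ins k 0 l)).
Proof.
move=> /polyfunP[s fE]; apply/polyfunP.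
exists [seq ([ffun j => t.1 (lift k j)], 0 ^+ t.1 k *: t.2) | t : {ffun 'I_n.+1 -> nat} * V <- s] => l.
rewrite fE big_map; apply: eq_bigr => t _ /=; rewrite scalerA mulrC.
rewrite (bigD1_ord k) //= ins_at; congr (_ * _ *: _).
by apply: eq_bigr => j _; rewrite ins_lift ffunE.
Qed.

(* The cancellation of the merge terms of d h + h d: t (k, j) inserts at k and
   then merges at j, s (k, j) merges first. *)
Lemma sum_insert_merge (V : zmodType) n (s t : nat -> nat -> V) :
  (forall k j, (k <= j < n)%N -> t k j.+1 = - s k j) ->
  (forall k j, (j < k <= n)%N -> t k.+1 j = - s k j) ->
  \sum_(j < n) \sum_(k < n.+1) s k j + \sum_(k < n.+2) \sum_(j < n.+1) t k j =
  \sum_(j < n.+1) (t j j + t j.+1 j).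
Proof.
move=> ts_le ts_gt; rewrite [X in _ + X]exchange_big /=.
(* For a merge at [j], only the insertions at [j] and [j.+1] involve the inserted entry in the
   merge. Those before and after are matched with the terms [s k j] having [k <= j] and [k > j]. *)
have split_t (j : 'I_n.+1) : \sum_(k < n.+2) t k j =
    (\sum_(0 <= k < j) t k j + \sum_(j.+2 <= k < n.+2) t k j) + (t j j + t j.+1 j).
  rewrite -(big_mkord xpredT (fun k => t k j)) (big_cat_nat (n := j)) //=; last first.
    by have := ltn_ord j; lia.
  have jn := ltn_ord j; rewrite [X in _ + X]big_ltn; last by lia.
  by rewrite [X in _ + (_ + X)]big_ltn ?ltnS // [t j j + (_ + _)]addrA -[RHS]addrA [X in _ + X]addrC.
have lowE : \sum_(j < n.+1) \sum_(0 <= k < j) t k j = \sum_(j < n) \sum_(0 <= k < j.+1) t k j.+1.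
  by rewrite big_ord_recl big_geq // add0r.
have highE : \sum_(j < n.+1) \sum_(j.+2 <= k < n.+2) t k j =
    \sum_(j < n) \sum_(j.+1 <= k < n.+1) t k.+1 j.
  by rewrite big_ord_recr /= [X in _ + X]big_geq // addr0; apply: eq_bigr => j _; rewrite big_add1.
rewrite (eq_bigr _ (fun j _ => split_t j)) big_split /= big_split /= addrA lowE highE.
rewrite -!big_split /= big1 ?add0r // => j _.
rewrite -(big_mkord xpredT (fun k => s k j)) (big_cat_nat (n := j.+1)) //=; last by rewrite ltnS ltnW.
rewrite addrACA -big_split -[X in _ + X]big_split /= !big_nat.
rewrite big1 ?add0r => [|k /andP[_ kj]]; last by rewrite ts_le ?subrr // -ltnS kj /=.
by apply: big1 => k /andP[jk kn]; rewrite ts_gt ?subrr // jk.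
Qed.

(* Finite families as restrictions of sequences: index shifts then become
   arithmetic on nat. *)
Section Sequences.
Variable X : Type.

Definition restr n (A : nat -> X) : 'I_n -> X := fun i => A i.

Definition extend (x0 : X) n (f : 'I_n -> X) : nat -> X := fun i => oapp f x0 (insub i).

Lemma restr_extend x0 n (f : 'I_n -> X) : restr (extend x0 f) = f.
Proof. by apply: funext => i; rewrite /restr /extend valK. Qed.

Definition insN (k : nat) (x : X) (A : nat -> X) : nat -> X :=
  fun i => if (i < k)%N then A i else if i == k then x else A i.-1.

Lemma ins_restr n (k : 'I_n.+1) x A : ins k x (restr A) = restr (insN k x A).
Proof.
apply: funext => i; rewrite /restr /insN; case: (unliftP k i) => [j|] ->.
  rewrite ins_lift /= /bump; case: (leqP k j) => kj.
    by rewrite add1n ltnNge leqW //= gtn_eqF.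
  by rewrite add0n kj.
by rewrite ins_at ltnn eqxx.
Qed.

Lemma insN_tail k x A : (fun i => insN k.+1 x A i.+1) = insN k x (fun i => A i.+1).
Proof.
apply: funext => i; rewrite /insN ltnS eqSS /=.
by case: ltngtP => // ki; rewrite prednK //; lia.
Qed.

End Sequences.

(** * The contracting homotopy and its formula *)

Section Homotopy.
Variables (F : fieldType) (C M : lmodType F) (D : C -> C) (pr : C -> C -> F -> C).
Variables (DM : M -> M) (act : C -> M -> F -> M) (v : C) (alpha : F).

(** Counterpart of [merge_args] on sequences, which avoids [inord]. *)
Definition mergeN (A : nat -> C) (L : nat -> F) (j : nat) : nat -> C :=
  fun i => if (i < j)%N then A i else if i == j then pr (A j) (A j.+1) (L j) else A i.+1.

Definition merge_lamN (L : nat -> F) (j : nat) : nat -> F :=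
  fun i => if (i < j)%N then L i else if i == j then L j + L j.+1 else L i.+1.

Ltac solve_index := apply: funext => i; rewrite /mergeN /merge_lamN /insN /=;
  repeat (case: ltngtP => ? /=); subst; rewrite ?add0r ?addr0 //;
  try (exfalso; lia); repeat f_equal; lia.

Lemma merge_insN_le k j A L : (k <= j)%N ->
  mergeN (insN k v A) (insN k 0 L) j.+1 = insN k v (mergeN A L j) /\
  merge_lamN (insN k 0 L) j.+1 = insN k 0 (merge_lamN L j).
Proof. by move=> kj; split; solve_index. Qed.

Lemma merge_insN_gt k j A L : (j < k)%N ->
  mergeN (insN k.+1 v A) (insN k.+1 0 L) j = insN k v (mergeN A L j) /\
  merge_lamN (insN k.+1 0 L) j = insN k 0 (merge_lamN L j).
Proof. by move=> jk; split; solve_index. Qed.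

(** The two insertions adjacent to the merge yield the two halves of the commutator with [v_(0)]. *)
Lemma merge_insN_eq j A L :
  mergeN (insN j v A) (insN j 0 L) j = (fun i => if i == j then pr v (A j) 0 else A i) /\
  mergeN (insN j.+1 v A) (insN j.+1 0 L) j = (fun i => if i == j then pr (A j) v (L j) else A i).
Proof. by split; solve_index. Qed.

Lemma merge_lam_insN j L :
  merge_lamN (insN j 0 L) j = L /\ merge_lamN (insN j.+1 0 L) j = L.
Proof. by split; solve_index. Qed.

Lemma merge_restr n (A : nat -> C) (L : nat -> F) (j : 'I_n) :
  merge_args pr (restr A) (restr L) j = restr (mergeN A L j).
Proof.
apply: funext => k; have [kn jn] := (ltn_ord k, ltn_ord j).
by rewrite /merge_args /restr /mergeN !inordK // ltnW.
Qed.

Lemma merge_lam_restr n (L : nat -> F) (j : 'I_n) :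
  merge_lam (restr L) j = restr (merge_lamN L j).
Proof.
apply: funext => k; have [kn jn] := (ltn_ord k, ltn_ord j).
by rewrite /merge_lam /restr /merge_lamN !inordK // ltnW.
Qed.

Lemma dco_restr n (phi : cochain C M n) A L :
  dco pr act phi (restr A) (restr L) =
  act (A 0%N) (phi (restr (fun i => A i.+1)) (restr (fun i => L i.+1))) (L 0%N)
  + \sum_(j < n) (-1) ^+ j.+1 *: phi (restr (mergeN A L j)) (restr (merge_lamN L j)).
Proof.
congr (_ + _); apply: eq_bigr => j _.
by rewrite merge_restr merge_lam_restr.
Qed.

Definition homotopy n (phi : cochain C M n.+1) : cochain C M n := fun args l =>
  \sum_(k < n.+1) (-1) ^+ k *: phi (ins k v args) (ins k 0 l).

Lemma homotopy_restr n (phi : cochain C M n.+1) A L :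
  homotopy phi (restr A) (restr L) =
  \sum_(k < n.+1) (-1) ^+ k *: phi (restr (insN k v A)) (restr (insN k 0 L)).
Proof. by apply: eq_bigr => k _; rewrite !ins_restr. Qed.

Lemma homotopy_is_cochain n (phi : cochain C M n.+1) :
  is_cochain D phi -> is_cochain D (homotopy phi).
Proof.
move=> [philin [phiD phipoly]]; split; last split.
- move=> args i a x y l; rewrite /homotopy scaler_sumr -big_split.
  apply: eq_bigr => k _ /=.
  by rewrite !ins_upd philin scalerDr !scalerA [_ * a]mulrC.
- move=> args i l; rewrite /homotopy scaler_sumr; apply: eq_bigr => k _.
  by rewrite ins_upd -(ins_lift k v args i) phiD ins_lift !scalerA mulrC.
- by move=> args; apply: polyfun_sum => k; apply: polyfun_ins0.
Qed.

(** The inserted variable is 0, so the sum of the variables is unchanged. *)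
Lemma Dco_homotopy n (phi : cochain C M n.+1) args l :
  klin DM -> homotopy (Dco DM phi) args l = Dco DM (homotopy phi) args l.
Proof.
move=> DMlin; rewrite /homotopy /Dco (klin_sum DMlin) scaler_sumr -big_split.
apply: eq_bigr => k _ /=; rewrite (klinZ DMlin) scalerDr; congr (_ + _).
rewrite (bigD1_ord k) //= ins_at add0r; under eq_bigr do rewrite ins_lift.
by rewrite !scalerA mulrC.
Qed.

Lemma cochain_lin n (a : F) (phi psi : cochain C M n) :
  is_cochain D phi -> is_cochain D psi ->
  is_cochain D (fun args l => a *: phi args l + psi args l).
Proof.
move=> [philin [phiD phipoly]] [psilin [psiD psipoly]]; split; last split.
- move=> args i c x y l; rewrite philin psilin [a *: (_ + _)]scalerDr addrACA.
  by rewrite [a *: (c *: _)]scalerA (mulrC a) -scalerA -[c *: _ + c *: _]scalerDr.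
- by move=> args i l; rewrite phiD psiD scalerA (mulrC a) -scalerA -scalerDr.
- by move=> args; apply: polyfun_lin.
Qed.

Lemma cochainZ n (a : F) (phi : cochain C M n) :
  is_cochain D phi -> is_cochain D (fun args l => a *: phi args l).
Proof.
move=> [philin [phiD phipoly]]; split; last split.
- by move=> args i c x y l; rewrite philin scalerDr !scalerA (mulrC a).
- by move=> args i l; rewrite phiD !scalerA (mulrC a).
- move=> args; have := polyfun_lin a (phipoly args) (polyfun0 M n).
  by under eq_fun do rewrite addr0.
Qed.

Lemma DcoZ n (a : F) (phi : cochain C M n) args l : klin DM ->
  Dco DM (fun args l => a *: phi args l) args l = a *: Dco DM phi args l.
Proof.
by move=> DMlin; rewrite /Dco (klinZ DMlin) scalerDr !scalerA (mulrC a).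
Qed.

Lemma DcoD n (phi psi : cochain C M n) args l : klin DM ->
  Dco DM (fun args l => phi args l + psi args l) args l =
  Dco DM phi args l + Dco DM psi args l.
Proof. by move=> DMlin; rewrite /Dco (klinD DMlin) scalerDr addrACA. Qed.

Hypothesis actlin : forall a l, klin (fun m => act a m l).

Lemma dcoZ n (a : F) (phi : cochain C M n) args l :
  dco pr act (fun args l => a *: phi args l) args l = a *: dco pr act phi args l.
Proof.
rewrite /dco (klinZ (actlin _ _)) scalerDr scaler_sumr; congr (_ + _).
by apply: eq_bigr => j _; rewrite !scalerA mulrC.
Qed.

Hypothesis act_v0 : forall m, act v m 0 = DM m + alpha *: m.
Hypothesis inner : forall a mu, exists c, pr v a 0 - pr a v mu + mu *: a = D c + mu *: c.

(** The error [D c + l j *: c] from [inner] dies in slot [j] by sesquilinearity. *)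
Lemma cochain_inner n (phi : cochain C M n) args l (j : 'I_n) : is_cochain D phi ->
  phi (upd args j (pr (args j) v (l j))) l - phi (upd args j (pr v (args j) 0)) l =
  l j *: phi args l.
Proof.
move=> [philin [phiD _]]; have [c /esym/eqP] := inner (args j) (l j).
have slot_lin : klin (fun x => phi (upd args j x) l) by move=> a x y; apply: philin.
have phiDc : phi (upd args j (D c)) l = - l j *: phi (upd args j c) l.
  have := phiD (upd args j c) j l; rewrite upd_upd.
  by rewrite {2}/upd eqxx.
move=> /eqP/(congr1 (fun x => phi (upd args j x) l)) /=.
rewrite !(klinD slot_lin) !(klinZ slot_lin) (klinN slot_lin) phiDc scaleNr addNr upd_id.
by move=> /esym/eqP; rewrite addrC addr_eq0 opprB => /eqP.
Qed.

(** Insertion at 0 contributes the action of [v_(0)], that is [DM + alpha]. Merges with the inserted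
    [v] contribute [l j *: phi] for each slot, which completes [DM] to [Dco]; everything else
    cancels. *)
Lemma homotopy_formula n (phi : cochain C M n.+1) args l : is_cochain D phi ->
  dco pr act (homotopy phi) args l + homotopy (dco pr act phi) args l =
  Dco DM phi args l + alpha *: phi args l.
Proof.
move=> phiC; rewrite -(restr_extend 0 args) -(restr_extend 0 l).
move: (extend 0 args) (extend 0 l) => A L {args l}.
pose P B K := phi (restr B) (restr K).
rewrite dco_restr !homotopy_restr.
pose s k j := (-1) ^+ j.+1 *: ((-1) ^+ k *:
  P (insN k v (mergeN A L j)) (insN k 0 (merge_lamN L j))) : M.
pose t k j := (-1) ^+ k *: ((-1) ^+ j.+1 *:
  P (mergeN (insN k v A) (insN k 0 L) j) (merge_lamN (insN k 0 L) j)) : M.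
have -> : \sum_(j < n) (-1) ^+ j.+1 *: homotopy phi (restr (mergeN A L j)) (restr (merge_lamN L j))
    = \sum_(j < n) \sum_(k < n.+1) s k j.
  by apply: eq_bigr => j _; rewrite homotopy_restr scaler_sumr.
have -> : \sum_(k < n.+2) (-1) ^+ k *: dco pr act phi (restr (insN k v A)) (restr (insN k 0 L))
    = DM (P A L) + alpha *: P A L
      - act (A 0%N) (\sum_(k < n.+1) (-1) ^+ k *: P (insN k v (fun i => A i.+1)) (insN k 0 (fun i => L i.+1))) (L 0%N)
      + \sum_(k < n.+2) \sum_(j < n.+1) t k j.
  under eq_bigr do rewrite dco_restr scalerDr scaler_sumr.
  rewrite big_split /=; congr (_ + _).
  (* For [k = 0] the outer action is by [v]; for [k > 0] it is by [A 0], with sign opposite to the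
     action term of [d h]. *)
  rewrite big_ord_recl scale1r act_v0; congr (_ + _).
  rewrite (klin_sum (actlin _ _)) -sumrN; apply: eq_bigr => k _.
  by rewrite (klinZ (actlin _ _)) exprS mulN1r scaleNr !insN_tail.
rewrite addrACA [X in X + _]addrC subrK sum_insert_merge; first last.
- move=> k j /andP[jk _]; rewrite /t /s; have [-> ->] := merge_insN_gt A L jk.
  by rewrite exprS mulN1r scaleNr !scalerA mulrC.
- move=> k j /andP[kj _]; rewrite /t /s; have [-> ->] := merge_insN_le A L kj.
  by rewrite [in LHS]exprS mulN1r scaleNr scalerN !scalerA mulrC.
(* The signs of [t j j] and [t j.+1 j] are -1 and +1, as in [cochain_inner]. *)
rewrite /Dco addrAC; congr (_ + _ + _); rewrite scaler_suml; apply: eq_bigr => j _.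
have <- := cochain_inner (restr A) (restr L) j phiC.
rewrite /t /P; have [-> ->] := merge_insN_eq j A L; have [-> ->] := merge_lam_insN j L.
by rewrite !scalerA -expr2 sqrr_sign scale1r exprS mulrCA mulN1r -expr2 sqrr_sign scaleN1r addrC.
Qed.
End Homotopy.

(** * Vanishing of the reduced cohomology *)

Theorem theorem4p3 (F : fieldType) (charF0 : [pchar F] =i pred0)
  (C : lmodType F) (D : C -> C) (pr : C -> C -> F -> C) (v : C)
  (hU3 : is_U3 D pr v)
  (alpha Delta : F) (halpha : alpha != 0)
  (act : C -> {poly F} -> F -> {poly F})
  (hM : is_M_alpha_Delta D pr v alpha Delta act) :
  forall m : nat, H_vanishes D pr (@Mpoly_D F) act m.
Proof.
move=> m phi phiC [theta [thetaC dphi]].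
have [[DMlin _ actlin _ _ actD _] actv1] := hM.
(* At variable 0 the action commutes with multiplication by ['X], so its value [alpha + 'X] at
   [u = 1] determines it. *)
have act_v0 p : act v p 0 = Mpoly_D p + alpha *: p.
  elim/poly_ind: p => [|p c IHp].
    by rewrite (klin0 (actlin _ _)) /Mpoly_D mulr0 scaler0 addr0.
  rewrite (klinD (actlin _ _)) mulrC (actD v p) scale0r addr0 IHp.
  rewrite -[c%:P]mulr1 mul_polyC (klinZ (actlin _ _)) actv1 mulr0 addr0 mulr1.
  rewrite /Mpoly_D -!mul_polyC mulr1; ring.
have formula := homotopy_formula actlin act_v0 (U3_inner_derivation charF0 hU3) _ _ phiC.
have dphiE : dco pr act phi = Dco (@Mpoly_D F) theta.
  by apply: funext => args; apply: funext.
exists (fun args l => alpha^-1 *: homotopy v phi args l).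
exists (fun args l => - alpha^-1 *: phi args l + alpha^-1 *: homotopy v theta args l).
have hthetaC := cochainZ alpha^-1 (homotopy_is_cochain v thetaC).
split; first exact/cochainZ/homotopy_is_cochain.
split; first exact: cochain_lin.
(* [D h theta = h D theta = h d phi], so the right side is [(d h phi + h d phi - D phi) / alpha]. *)
move=> args l; rewrite (dcoZ pr actlin) DcoD // !DcoZ // -Dco_homotopy // -dphiE.
rewrite scaleNr addrCA addrC -scalerDr formula -scalerBr addrAC subrr add0r.
by rewrite scalerA mulVf // scale1r.
Qed.
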